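(* For every real $\varepsilon$ with $0<\varepsilon<1$, there exist $X_1,X_2,X_3\in\mathbb M_3(\mathbb C)$ such that $$X_1+X_2+X_3=I_3\qquad\text{and}\qquad \lambda_2\bigl(|X_1|+|X_2|+|X_3|\bigr)=\varepsilon .$$
   Context: $\mathbb M_3(\mathbb C)$ is the algebra of complex $3\times3$ matrices and $I_3$ its identity. $|X|=(X^*X)^{1/2}$. For Hermitian $T\in\mathbb M_3(\mathbb C)$, $\lambda_1(T)\ge\lambda_2(T)\ge\lambda_3(T)$ are its eigenvalues counted with multiplicity. *)

(* Defs.v *)
From mathcomp Require Import all_boot all_order all_algebra.
From mathcomp Require Import sesquilinear spectral complex reals.

Set Implicit Arguments.
Unset Strict Implicit.
Unset Printing Implicit Defensive.

Import Order.TTheory GRing.Theory Num.Theory Num.Def.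
Local Open Scope ring_scope.
Local Open Scope complex_scope.
Local Open Scope sesquilinear_scope.

Section Modulus.
Context {C : numClosedFieldType} {n : nat}.
Implicit Types X A P Q : 'M[C]_n.

Definition psdmx A : Prop :=
  A \is hermsymmx /\ forall v : 'cV[C]_n, 0 <= (v^t* *m A *m v) 0 0.

(* The square root of a positive semidefinite matrix, by functional calculus
   on the spectral decomposition A = U^-1 diag(d) U; [sqrtC] is the nonnegative
   square root of a nonnegative number. Meaningless if A is not positive
   semidefinite. *)
Definition sqrtmx A : 'M[C]_n :=
  invmx (spectralmx A) *m diag_mx (map_mx sqrtC (spectral_diag A))
    *m spectralmx A.

(* |X| = (X^* X)^{1/2}; see [absmxP] for the characterization of |X| as the
   unique positive semidefinite square root of X^* X. *)
Definition absmx X : 'M[C]_n := sqrtmx (X^t* *m X).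

Lemma hermsymmxP A : reflect (A = A^t*) (A \is hermsymmx).
Proof.
by apply: (iffP (is_hermitianmxP _ _ _)); rewrite expr0 scale1r.
Qed.

Lemma trmxC_mul m p q (A : 'M[C]_(m, p)) (B : 'M[C]_(p, q)) :
  (A *m B)^t* = B^t* *m A^t*.
Proof. by rewrite trmx_mul map_mxM. Qed.

Lemma dot_ge0 m (v : 'cV[C]_m) : 0 <= (v^t* *m v) 0 0.
Proof.
rewrite mxE; apply: sumr_ge0 => i _; rewrite !mxE mulrC; exact: mul_conjC_ge0.
Qed.

Lemma psdmx_gram X : psdmx (X^t* *m X).
Proof.
split; first by apply/hermsymmxP; rewrite trmxC_mul trmxCK.
move=> v; rewrite mulmxA -trmxC_mul -mulmxA; exact: dot_ge0.
Qed.

Lemma spectralP A : A \is hermsymmx ->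
  A = (spectralmx A)^t* *m diag_mx (spectral_diag A) *m spectralmx A.
Proof.
move=> /hermitian_normalmx/orthomx_spectralP {1}->.
by rewrite invmx_unitary ?spectral_unitarymx.
Qed.

Lemma psdmx_spectral_ge0 A i : psdmx A -> 0 <= spectral_diag A 0 i.
Proof.
case=> hA /(_ ((spectralmx A)^t* *m delta_mx i 0)).
have U1 := unitarymxP (spectral_unitarymx A).
rewrite {2}(spectralP hA) trmxC_mul trmxCK !mulmxA.
rewrite -(mulmxA _ (spectralmx A)) U1 mulmx1 -(mulmxA _ (spectralmx A)) U1 mulmx1.
rewrite -mulmxA -colE mxE (bigD1 i) //= big1 ?addr0 => [|j ji].
  by rewrite !mxE !eqxx mulr1n conjC1 mul1r.
by rewrite !mxE eqxx (negPf ji) conjC0 mul0r.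
Qed.

Lemma sqrtmx_psd A : psdmx A -> psdmx (sqrtmx A).
Proof.
move=> pA; rewrite /sqrtmx invmx_unitary ?spectral_unitarymx //.
set U := spectralmx A; set d := spectral_diag A.
have d0 i : 0 <= sqrtC (d 0 i) by rewrite sqrtC_ge0 psdmx_spectral_ge0.
split.
  apply/hermsymmxP; rewrite !trmxC_mul trmxCK mulmxA; congr (_ *m _ *m _).
  apply/matrixP=> i j; rewrite !mxE eq_sym.
  have [->|] := eqVneq; last by rewrite !mulr0n conjC0.
  by rewrite !mulr1n; apply/esym/CrealP/ger0_real.
move=> v; rewrite -!mulmxA (mulmxA _ (U^t*)) -trmxC_mul.
set w := U *m v; rewrite mxE sumr_ge0 // => i _.
rewrite mul_diag_mx !mxE mulrCA mulr_ge0 // mulrC; exact: mul_conjC_ge0.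
Qed.

Lemma sqrtmx_sqr A : psdmx A -> sqrtmx A *m sqrtmx A = A.
Proof.
move=> [hA _]; rewrite /sqrtmx invmx_unitary ?spectral_unitarymx //.
have U1 := unitarymxP (spectral_unitarymx A).
rewrite [RHS](spectralP hA) !mulmxA -(mulmxA _ (spectralmx A)) U1 mulmx1.
rewrite -(mulmxA _ (diag_mx _) (diag_mx _)) mulmx_diag.
congr (_ *m diag_mx _ *m _); apply/rowP=> i.
by rewrite !mxE -expr2 sqrtCK.
Qed.

Lemma psdmx_sqr_inj P Q : psdmx P -> psdmx Q -> P *m P = Q *m Q -> P = Q.
Proof.
move=> pP pQ; have [[hP _] [hQ _]] := (pP, pQ).
have U1 := unitarymxP (spectral_unitarymx P).
have V1 := unitarymxP (spectral_unitarymx Q).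
have U2 := mulmx1C U1; have V2 := mulmx1C V1.
move: (spectralP hP) (spectralP hQ) U1 V1 U2 V2.
have d0 i := psdmx_spectral_ge0 i pP; have e0 i := psdmx_spectral_ge0 i pQ.
move: d0 e0.
set U := spectralmx P; set V := spectralmx Q.
set d := spectral_diag P; set e := spectral_diag Q.
move=> d0 e0 eP eQ U1 V1 U2 V2 PQ.
pose W := V *m U^t*.
have UP : P *m U^t* = U^t* *m diag_mx d by rewrite eP -mulmxA U1 mulmx1.
have VQ : V *m Q = diag_mx e *m V by rewrite eQ !mulmxA V1 mul1mx.
have WW : diag_mx e *m (diag_mx e *m W) = W *m diag_mx d *m diag_mx d.
  rewrite /W !mulmxA -(mulmxA _ _ V) -VQ !mulmxA -VQ -(mulmxA V) -PQ.
  by rewrite -!mulmxA UP (mulmxA P) UP !mulmxA.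
have WD : diag_mx e *m W = W *m diag_mx d.
  move: WW; clearbody W; move=> WW.
  apply/matrixP=> i j; have /matrixP/(_ i j) := WW.
  rewrite !(mul_diag_mx, mul_mx_diag).
  rewrite !mxE => /eqP.
  have [->|W0] := eqVneq (W i j) 0; first by rewrite !(mulr0, mul0r).
  rewrite mulrA -[W i j * _ * _]mulrA [W i j * (_ * _)]mulrC -!expr2.
  by rewrite (inj_eq (mulIf W0)) eqrXn2 ?e0 ?d0 // => /eqP->; rewrite mulrC.
have -> : Q = V^t* *m (V *m Q) by rewrite mulmxA V2 mul1mx.
have -> : P = P *m U^t* *m U by rewrite -mulmxA U2 mulmx1.
have VE : V = W *m U by rewrite /W -mulmxA U2 mulmx1.
rewrite UP VQ [X in diag_mx e *m X]VE (mulmxA (diag_mx e)) WD /W.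
by rewrite -!mulmxA (mulmxA (V^t*)) V2 mul1mx.
Qed.

Lemma absmxP X P : P = absmx X <-> psdmx P /\ P *m P = X^t* *m X.
Proof.
have pX := psdmx_gram X; split=> [->|[pP eP]].
  by split; [apply: sqrtmx_psd | apply: sqrtmx_sqr].
by apply: psdmx_sqr_inj => //; rewrite ?sqrtmx_sqr //; apply: sqrtmx_psd.
Qed.

End Modulus.

Section Eigenvalues.
Context {R : realType} {n : nat}.
Implicit Type T : 'M[R[i]]_n.

(* All complex eigenvalues with algebraic multiplicity, in no specified order:
   the roots of the characteristic polynomial. *)
Definition ceigenvalues T : seq R[i] :=
  sval (closed_field_poly_normal (char_poly T)).

(* The eigenvalues of a Hermitian T in nonincreasing order. The real part
   forgets nothing, as these eigenvalues are real: see [eigenvaluesP]. *)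
Definition eigenvalues T : seq R :=
  sort >=%R [seq complex.Re z | z <- ceigenvalues T].

(* lambda_k(T), with the indexing starting at k = 1. *)
Definition lambda (k : nat) T : R := (eigenvalues T)`_k.-1.

Lemma ceigenvaluesP T :
  char_poly T = \prod_(z <- ceigenvalues T) ('X - z%:P).
Proof.
rewrite /ceigenvalues; case: closed_field_poly_normal => s /=.
by rewrite (monicP (char_poly_monic T)) scale1r.
Qed.

Lemma size_eigenvalues T : size (eigenvalues T) = n.
Proof.
apply: succn_inj; rewrite size_sort size_map -(size_char_poly T) ceigenvaluesP.
by rewrite size_prod_XsubC.
Qed.

Lemma eigenvalues_sorted T : sorted >=%R (eigenvalues T).
Proof. by apply: sort_sorted => x y; apply: le_total. Qed.

Lemma hermsymmx_root_real T z :
  T \is hermsymmx -> root (char_poly T) z -> z \is Num.real.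
Proof.
move=> hT; rewrite -eigenvalue_root_char => /eigenvalueP[v vT v0].
have vv : 0 < (v *m v^t*) 0 0 by rewrite -dotmxE dnorm_gt0.
have e1 : (v *m T *m v^t*) 0 0 = z * (v *m v^t*) 0 0.
  by rewrite vT -scalemxAl mxE.
have : (v *m T *m v^t*)^t* = v *m T *m v^t*.
  by rewrite !trmxC_mul trmxCK mulmxA -(hermsymmxP _ hT).
move=> /matrixP/(_ 0 0); rewrite [LHS]mxE [in LHS]mxE e1 rmorphM /=.
rewrite (CrealP (gtr0_real vv)) => /(mulIf (lt0r_neq0 vv)) zz.
exact/CrealP.
Qed.

Lemma eigenvaluesP T : T \is hermsymmx ->
  char_poly T = \prod_(x <- eigenvalues T) ('X - (x%:C)%:P).
Proof.
move=> hT; rewrite (perm_big _ (permEl (perm_sort _ _))) /=.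
rewrite big_map [LHS]ceigenvaluesP; apply: eq_big_seq => z zs.
rewrite RRe_real //; apply: (hermsymmx_root_real hT).
by rewrite ceigenvaluesP root_prod_XsubC.
Qed.

End Eigenvalues.

(* Main.v *)
(** If [V = I + t J] with [J] the all-ones matrix, [U = V^-1 = I + r J] has the
   same shape, and the columns [u_k], [v_k] of [U], [V] give a decomposition of
   the identity into rank one matrices [u_k v_k^*]. As [|u_k| / |v_k|] does not
   depend on [k], [|u_k v_k^*| = (|u_k| / |v_k|) v_k v_k^*], so the moduli sum
   to [(|u_k| / |v_k|) V^2]. This has eigenvalue [|u_k| / |v_k|] with
   multiplicity at least two, and [t] can be chosen to make this ratio [eps]. *)

Require Import Defs.
From mathcomp Require Import all_boot all_order all_algebra complex reals.
From mathcomp Require Import spectral ring.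

Import Order.TTheory GRing.Theory Num.Theory.

Local Open Scope ring_scope.
Local Open Scope complex_scope.
Local Open Scope sesquilinear_scope.

(** By uniqueness of the positive semidefinite square root: both squares equal |u|^2 v v^*. *)
Lemma absmx_rank1 (C : numClosedFieldType) (n : nat) (u v : 'cV[C]_n) (e : C) :
  0 <= e -> (u^t* *m u) 0 0 = e ^+ 2 * (v^t* *m v) 0 0 ->
  absmx (u *m v^t*) = e *: (v *m v^t*).
Proof.
move=> e0 uv; apply/esym/absmxP; split; last first.
  rewrite trmxC_mul trmxCK -scalemxAl -scalemxAr scalerA -expr2 !mulmxA.
  rewrite -(mulmxA v (u^t*)) -(mulmxA v (v^t*)).
  rewrite (mx11_scalar (u^t* *m u)) (mx11_scalar (v^t* *m v)) uv.
  by rewrite !mul_mx_scalar -!scalemxAl scalerA.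
split=> [|x].
  apply/hermsymmxP; rewrite linearZ map_mxZ /= trmxC_mul trmxCK.
  by rewrite (CrealP (ger0_real e0)).
rewrite -scalemxAr -scalemxAl mxE mulr_ge0 // mulmxA -(mulmxA _ _ x).
by have := dot_ge0 (v^t* *m x); rewrite trmxC_mul trmxCK.
Qed.

(** A product of monic linear factors determines its roots up to order, which sorting removes. *)
Lemma eigenvalues_char_poly (R : realType) (n : nat) (T : 'M[R[i]]_n)
    (s : seq R) :
  char_poly T = \prod_(x <- s) ('X - (x%:C)%:P) -> eigenvalues T = sort >=%R s.
Proof.
rewrite ceigenvaluesP -(big_map (real_complex R) xpredT (fun z => 'X - z%:P)).
move=> /prod_XsubC_eq /(perm_map (@complex.Re R)).
rewrite -map_comp [X in perm_eq _ X]map_id_in // => Ts.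
apply/perm_sortP => //.
- by move=> x y; apply: le_total.
- exact: ge_trans.
- exact: ge_anti.
Qed.

(* Sylvester's identity, multiplied by [y] to avoid the exponent [n - 1]. *)
Lemma det_scalar_sub_rank1 (A : comPzRingType) (n : nat) (y : A)
    (u : 'cV[A]_n) (v : 'rV[A]_n) :
  \det (y%:M - u *m v) * y = (y - (v *m u) 0 0) * y ^+ n.
Proof.
(* Two block triangular factors compute det M: one gives det (y - u v), the other turns y det M into
   (y - v u) y^n. *)
pose M : 'M_(1 + n) := block_mx 1%:M v u y%:M.
have M1 : M *m block_mx 1%:M (- v) 0 1%:M = block_mx 1%:M 0 u (y%:M - u *m v).
  rewrite mulmx_block !mulmx1 !mulmx0 !addr0 !mul1mx addNr mulmxN.
  by rewrite [_ + y%:M]addrC.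
have M2 : M *m block_mx y%:M 0 (- u) 1%:M
    = block_mx (y%:M - v *m u) v 0 y%:M.
  rewrite mulmx_block !mulmx1 !mulmx0 !add0r !mul1mx !mulmxN.
  by rewrite mul_mx_scalar mul_scalar_mx addrN.
have /(congr1 determinant) := M1; have /(congr1 determinant) := M2.
rewrite !det_mulmx !det_ublock !det_lblock !det1 !det_scalar expr1 !mulr1 mul1r.
by move=> Ey <-; rewrite Ey det_mx11 !mxE mulr1n.
Qed.

Lemma char_poly_scalar_add_rank1 (A : idomainType) (n : nat) (a : A)
    (u : 'cV[A]_n.+1) (v : 'rV[A]_n.+1) :
  char_poly (a%:M + u *m v)
    = ('X - a%:P) ^+ n * ('X - (a + (v *m u) 0 0)%:P).
Proof.
(* This is the determinant identity at y = 'X - a, with the extra factor y cancelled. *)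
apply: (mulIf (negbT (polyXsubC_eq0 a))).
rewrite /char_poly /char_poly_mx map_mxD map_scalar_mx map_mxM /= opprD addrA.
rewrite -raddfB det_scalar_sub_rank1 -map_mxM [in LHS]mxE polyCD exprS; ring.
Qed.

(** Entry (i, j) of (I + s J)(I + t J) = I + (s + t + n s t) J, with J all ones. *)
Lemma sum_delta_mul (A : comPzRingType) (n : nat) (i j : 'I_n) (s t : A) :
  \sum_k ((i == k)%:R + s) * ((j == k)%:R + t)
    = (i == j)%:R + (s + t + s * t *+ n).
Proof.
have sumd (l : 'I_n) : \sum_k (l == k)%:R = 1 :> A.
  by rewrite (bigD1 l) //= eqxx big1 ?addr0 // => k /negPf; rewrite eq_sym => ->.
have sumdd : \sum_k (i == k)%:R * (j == k)%:R = (i == j)%:R :> A.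
  rewrite (bigD1 i) //= eqxx mul1r big1 ?addr0 1?eq_sym // => k /negPf.
  by rewrite eq_sym => ->; rewrite mul0r.
under eq_bigr => k _ do rewrite mulrDl !mulrDr.
rewrite !big_split /= sumr_const card_ord -mulr_suml -mulr_sumr !sumd sumdd.
by rewrite mul1r mulr1 -!addrA; congr (_ + _); rewrite addrCA.
Qed.

(* In dimension 3, if [V] has eigenvalues [w, 1, 1] then
   [|v_k|^2 = (w^2 + 2) / 3] and [|u_k|^2 = (w^-2 + 2) / 3]. *)
Lemma exists_norm_ratio (R : rcfType) (eps : R) : 0 < eps ->
  exists2 w : R, 0 < w & w^-1 ^+ 2 + 2 = eps ^+ 2 * (w ^+ 2 + 2).
Proof.
(* For y = w^2 the equation reads eps^2 y^2 - 2 (1 - eps^2) y - 1 = 0; [y] is its positive root and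
   [d] a quarter of its discriminant. *)
move=> e0; pose d := (1 - eps ^+ 2) ^+ 2 + eps ^+ 2.
have e2 : 0 < eps ^+ 2 by rewrite exprn_gt0.
have d0 : 0 <= d by rewrite addr_ge0 ?sqr_ge0.
pose y := (1 - eps ^+ 2 + Num.sqrt d) / eps ^+ 2.
have sd : - (1 - eps ^+ 2) < Num.sqrt d.
  apply: le_lt_trans (ler_norm _) _.
  by rewrite normrN -sqrtr_sqr ltr_sqrt /d ?ltrDl // ltr_wpDl ?sqr_ge0.
have y0 : 0 < y by rewrite divr_gt0 // -ltrBlDl sub0r.
have yE : 2 * y + 1 = eps ^+ 2 * y * (y + 2).
  have ne : eps != 0 by rewrite gt_eqF.
  have /eqP := sqr_sqrtr d0; rewrite -subr_eq0 => /eqP E.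
  (* The two sides differ by -1/eps^2 times (sqrt d)^2 - d, which is 0 by [E]. *)
  apply/eqP; rewrite -subr_eq0 -[0 in X in _ == X](mul0r (- (eps ^+ 2)^-1)) -E.
  by apply/eqP; rewrite /y /d; field.
exists (Num.sqrt y); first by rewrite sqrtr_gt0.
rewrite exprVn sqr_sqrtr ?(ltW y0) //; apply: (mulfI (lt0r_neq0 y0)).
by rewrite mulrDr divff ?lt0r_neq0 // addrC [y * 2]mulrC yE; ring.
Qed.

Section ShiftedBasis.
Context {C : numClosedFieldType} {n : nat}.
Implicit Types (s t : C) (k : 'I_n).

Definition shifted_basis t k : 'cV[C]_n := \col_i ((i == k)%:R + t).

Lemma shifted_basis_conj t k : t \is Num.real ->
  (shifted_basis t k)^t* = \row_i ((i == k)%:R + t).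
Proof.
by move=> rt; apply/rowP=> i; rewrite !mxE rmorphD /= (CrealP rt) conjC_nat.
Qed.

Lemma shifted_basis_norm t k : t \is Num.real ->
  ((shifted_basis t k)^t* *m shifted_basis t k) 0 0
    = 1 + (t + t + t * t *+ n).
Proof.
move=> rt; rewrite shifted_basis_conj // mxE.
under eq_bigr => i _ do rewrite !mxE eq_sym.
by rewrite sum_delta_mul eqxx.
Qed.

(** The product (I + s J)(I + t J) expanded by columns, with J in rank one form to fit
    [char_poly_scalar_add_rank1]. *)
Lemma sum_shifted_basis s t : t \is Num.real ->
  \sum_k shifted_basis s k *m (shifted_basis t k)^t*
    = 1%:M + ((s + t + s * t *+ n) *: const_mx 1) *m (const_mx 1 : 'rV_n).
Proof.
move=> rt; apply/matrixP=> i j; rewrite summxE.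
under eq_bigr => k _ do
  rewrite shifted_basis_conj // mxE big_ord1 !mxE.
by rewrite sum_delta_mul !mxE big_ord1 !mxE !mulr1.
Qed.

End ShiftedBasis.

Theorem proposition2p6 (R : realType) (eps : R) :
  0 < eps -> eps < 1 ->
  exists X1 X2 X3 : 'M[R[i]]_3,
    X1 + X2 + X3 = 1%:M /\
    lambda 2 (absmx X1 + absmx X2 + absmx X3) = eps.
Proof.
move=> e0 _; have [w w0 wE] := exists_norm_ratio _ _ e0.
have nw : w != 0 by rewrite gt_eqF.
(* On the all-ones vector, I + r J and I + t J have eigenvalues 1 + 3r = w^-1 and 1 + 3t = w, so
   they are inverse to each other. *)
pose r := (w^-1 - 1) / 3; pose t := (w - 1) / 3.
have real_real (x : R) : x%:C \is Num.real by apply/complex_realP; exists x.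
pose v k := shifted_basis t%:C k : 'cV[R[i]]_3.
pose X k := shifted_basis r%:C k *m (v k)^t*.
have sumI : \sum_k X k = 1%:M.
  rewrite sum_shifted_basis //.
  suff -> : r%:C + t%:C + r%:C * t%:C *+ 3 = 0 by rewrite scale0r mul0mx addr0.
  rewrite -!rmorphM -rmorphMn -!rmorphD /=.
  suff -> : r + t + r * t *+ 3 = 0 by [].
  by rewrite /r /t; field.
have absX k : absmx (X k) = eps%:C *: (v k *m (v k)^t*).
  apply: absmx_rank1; first by rewrite lecR ltW.
  have normC (x : R) : 1 + (x%:C + x%:C + x%:C * x%:C *+ 3)
      = (1 + (x + x + x * x *+ 3))%:C.
    by rewrite !(rmorphD, rmorphM, rmorphMn, rmorph1).
  rewrite !shifted_basis_norm // !normC -rmorphXn -rmorphM /=; congr _%:C.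
  have -> : 1 + (r + r + r * r *+ 3) = (w^-1 ^+ 2 + 2) / 3.
    by rewrite /r; field.
  by rewrite wE /t; field.
pose b := t + t + t * t *+ 3.
have sum_abs : \sum_k absmx (X k)
    = eps%:C%:M + ((eps * b)%:C *: const_mx 1) *m (const_mx 1 : 'rV_3).
  under eq_bigr => k _ do rewrite absX.
  rewrite -scaler_sumr sum_shifted_basis // scalerDr scale_scalar_mx mulr1.
  by rewrite scalemxAl scalerA /b !(rmorphM, rmorphD, rmorphMn).
have sum3 (F : 'I_3 -> 'M[R[i]]_3) :
    F 0 + F 1 + F (inord 2) = \sum_k F k.
  rewrite !big_ord_recl big_ord0 addr0 addrA; congr (_ + F _ + F _);
  by apply: val_inj; rewrite /= ?inordK.
exists (X 0), (X 1), (X (inord 2)); rewrite sum3 sumI; split=> //.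
rewrite (sum3 (absmx \o X)) /= sum_abs.
set T := _ + _.
(* The last root is eps (1 + 3b) = eps w^2. *)
have /eigenvalues_char_poly : char_poly T
    = \prod_(x <- [:: eps; eps; eps + eps * b *+ 3]) ('X - (x%:C)%:P).
  rewrite char_poly_scalar_add_rank1 !big_cons big_nil mulr1 expr2 mulrA.
  congr (_ * ('X - _%:P)); rewrite -scalemxAr !mxE.
  under eq_bigr => i _ do rewrite !mxE mul1r.
  by rewrite sumr_const card_ord [RHS]rmorphD [in RHS]rmorphMn mulr_natr.
(* Wherever the last root is sorted, [eps] fills two of the three places, hence the middle one. *)
by rewrite /lambda => ->; rewrite /sort /= lexx /=; case: (_ <= eps).
Qed.
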